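(* Let $r\le l\le2r-2$, $\mathbf{x}^*=(x_1^*,x_2^* )\in[x^{(1)}_{i_1-1},x^{(1)}_{i_1}]\times[x^{(2)}_{i_2-1},x^{(2)}_{i_2}]$, and let $\mathbf j=(j_1,j_2)$ with $0\le j_1,j_2\le(2r-2)-l$. Then $$p^{l+1}_{\mathbf j}(\mathbf x^* )=\sum_{\mathbf j_1\in\mathbf j+\{0,1\}^2}C^l_{\mathbf j,\mathbf j_1}(\mathbf x^* )\,p^l_{\mathbf j_1}(\mathbf x^* )$$ with $$C^l_{\mathbf j,\mathbf j+(0,0)}(\mathbf x^* )=\left(\frac{x^*_1-x^{(1)}_{i_1-r+j_1+l+1}}{x^{(1)}_{i_1-r+j_1}-x^{(1)}_{i_1-r+j_1+l+1}}\right)\left(\frac{x^*_2-x^{(2)}_{i_2-r+j_2+l+1}}{x^{(2)}_{i_2-r+j_2}-x^{(2)}_{i_2-r+j_2+l+1}}\right)=C^l_{j_1,j_1}(x_1^* )C^l_{j_2,j_2}(x_2^* ),$$ $$C^l_{\mathbf j,\mathbf j+(1,0)}(\mathbf x^* )=\left(\frac{x^{(1)}_{i_1-r+j_1}-x^*_1}{x^{(1)}_{i_1-r+j_1}-x^{(1)}_{i_1-r+j_1+l+1}}\right)\left(\frac{x^*_2-x^{(2)}_{i_2-r+j_2+l+1}}{x^{(2)}_{i_2-r+j_2}-x^{(2)}_{i_2-r+j_2+l+1}}\right)=C^l_{j_1,j_1+1}(x_1^* )C^l_{j_2,j_2}(x_2^* ),$$ $$C^l_{\mathbf j,\mathbf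 j+(0,1)}(\mathbf x^* )=\left(\frac{x^*_1-x^{(1)}_{i_1-r+j_1+l+1}}{x^{(1)}_{i_1-r+j_1}-x^{(1)}_{i_1-r+j_1+l+1}}\right)\left(\frac{x^{(2)}_{i_2-r+j_2}-x^*_2}{x^{(2)}_{i_2-r+j_2}-x^{(2)}_{i_2-r+j_2+l+1}}\right)=C^l_{j_1,j_1}(x_1^* )C^l_{j_2,j_2+1}(x_2^* ),$$ $$C^l_{\mathbf j,\mathbf j+(1,1)}(\mathbf x^* )=\left(\frac{x^{(1)}_{i_1-r+j_1}-x^*_1}{x^{(1)}_{i_1-r+j_1}-x^{(1)}_{i_1-r+j_1+l+1}}\right)\left(\frac{x^{(2)}_{i_2-r+j_2}-x^*_2}{x^{(2)}_{i_2-r+j_2}-x^{(2)}_{i_2-r+j_2+l+1}}\right)=C^l_{j_1,j_1+1}(x_1^* )C^l_{j_2,j_2+1}(x_2^* ).$$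
   Context: For $q=1,2$ let $a_q=x^{(q)}_0<x^{(q)}_1<\dots<x^{(q)}_{J_q}=b_q$ be (not necessarily uniform) grids, and let $f:[a_1,b_1]\times[a_2,b_2]\to\mathbb R$. Let $r\in\mathbb N$ and $(i_1,i_2)\in\mathbb N^2$ with $0\le i_q-r\le i_q+r-1\le J_q$, $q=1,2$. For $r\le l\le2r-1$ and $\mathbf k=(k_1,k_2)\in\{0,\dots,2r-1-l\}^2$, $p^l_{\mathbf k}$ denotes the unique polynomial in two variables of degree at most $l$ in each variable that interpolates $f$ at the nodes $\{x^{(1)}_{i_1-r+k_1},\dots,x^{(1)}_{i_1-r+k_1+l}\}\times\{x^{(2)}_{i_2-r+k_2},\dots,x^{(2)}_{i_2-r+k_2+l}\}$. For $r\le l\le 2r-2$, $0\le k\le2r-2-l$ and $q=1,2$, the univariate weights are $$C^l_{k,k}(x^*_q)=\frac{x^*_q-x^{(q)}_{i_q-r+k+l+1}}{x^{(q)}_{i_q-r+k}-x^{(q)}_{i_q-r+k+l+1}},\qquad C^l_{k,k+1}(x^*_q)=\frac{x^{(q)}_{i_q-r+k}-x^*_q}{x^{(q)}_{i_q-r+k}-x^{(q)}_{i_q-r+k+l+1}}.$$ *)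

(* Defs.v *)
From mathcomp Require Import all_boot all_order all_algebra.
From mathcomp Require Import classical_sets reals.

Set Implicit Arguments.
Unset Strict Implicit.
Unset Printing Implicit Defensive.

Import Order.TTheory GRing.Theory Num.Theory.
Local Open Scope ring_scope.

(* Only the values x 0, ..., x J are meaningful. *)
Definition is_grid (R : realType) (a b : R) (J : nat) (x : nat -> R) : Prop :=
  [/\ x 0%N = a, x J = b & forall n, (n < J)%N -> x n < x n.+1].

Definition stencil (R : realType) (x : nat -> R) (i r k : nat) : nat -> R :=
  fun m => x (i - r + k + m)%N.

(* size p - 1 is the degree of p in its first variable, sizeY p - 1 the degree
   in the second one. *)
Definition interpolates (R : realType) (f : R -> R -> R) (l : nat)
    (s t : nat -> R) (p : {poly {poly R}}) : Prop :=
  [/\ (size p <= l.+1)%N, (sizeY p <= l.+1)%N &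
      forall m1 m2, (m1 <= l)%N -> (m2 <= l)%N ->
        p.[s m1, t m2] = f (s m1) (t m2)].

Section Interpolation.
Variables (R : realType) (l : nat).

Definition inj_upto (s : nat -> R) : Prop :=
  forall m n, (m <= l)%N -> (n <= l)%N -> s m = s n -> m = n.

Definition lag (s : nat -> R) (i : 'I_l.+1) : {poly R} :=
  \prod_(k < l.+1 | k != i) ((s i - s k)^-1 *: ('X - (s k)%:P)).

Lemma size_lag s i : (size (lag s i) <= l.+1)%N.
Proof.
apply: leq_trans (size_poly_prod_leq _ _) _.
set n := #|_|; have En : n = l.
  by have := cardC1 i; rewrite card_ord.
have : (\sum_(k < l.+1 | k != i)
          size ((s i - s k)^-1 *: ('X - (s k)%:P)) <= n * 2)%N.
  rewrite -sum_nat_const; apply: leq_sum => k _.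
  by apply: leq_trans (size_scale_leq _ _) _; rewrite size_XsubC.
rewrite En => H; rewrite leq_subLR; apply: leq_ltn_trans H _.
by rewrite muln2 -addnn addnS.
Qed.

Lemma lag_eval s (i j : 'I_l.+1) :
  inj_upto s -> (lag s i).[s j] = (i == j)%:R.
Proof.
move=> s_inj; rewrite horner_prod.
case: (eqVneq i j) => [<-|ij].
  apply: big1 => k ki; rewrite hornerZ hornerXsubC mulVf // subr_eq0.
  by apply: contraNneq ki => /s_inj e; apply/eqP/val_inj/esym/e; rewrite -ltnS.
rewrite (bigD1 j) 1?eq_sym //= hornerZ hornerXsubC subrr mulr0 mul0r.
by [].
Qed.

Lemma interpolates_unique (f : R -> R -> R) (s t : nat -> R) p q :
  inj_upto s -> inj_upto t ->
  interpolates f l s t p -> interpolates f l s t q -> p = q.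
Proof.
move=> s_inj t_inj [p1 p2 p3] [q1 q2 q3]; apply/eqP; rewrite -subr_eq0.
have uni (u : nat -> R) : inj_upto u -> uniq (mkseq u l.+1).
  move=> u_inj; rewrite map_inj_in_uniq ?iota_uniq // => m n.
  by rewrite !mem_iota !add0n !ltnS => ml nl; apply: u_inj.
set d := p - q.
have d1 : (size d <= l.+1)%N.
  by apply: leq_trans (size_polyD _ _) _; rewrite size_polyN geq_max p1.
have d2 : (sizeY d <= l.+1)%N.
  rewrite sizeYE rmorphB; apply: leq_trans (size_polyD _ _) _.
  by rewrite size_polyN geq_max -!sizeYE p2.
apply/eqP; apply: (@roots_geq_poly_eq0 _ _ (map polyC (mkseq s l.+1))).
- apply/allP => z /mapP[y /mapP[m1]]; rewrite mem_iota add0n ltnS => m1l -> ->.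
  apply/eqP; apply: (@roots_geq_poly_eq0 _ _ (mkseq t l.+1)); last 1 first.
  + by rewrite size_mkseq; apply: leq_trans (max_size_evalC _ _) _.
  + apply/allP => z' /mapP[m2]; rewrite mem_iota add0n ltnS => m2l ->.
    by rewrite /root /d !hornerE p3 // q3 // subrr.
  + exact: uni.
- by rewrite map_inj_uniq ?uni //; apply: polyC_inj.
- by rewrite size_map size_mkseq.
Qed.

Lemma interpolates_exists (f : R -> R -> R) (s t : nat -> R) :
  inj_upto s -> inj_upto t -> exists p, interpolates f l s t p.
Proof.
move=> s_inj t_inj.
exists (\sum_(i < l.+1) \sum_(j < l.+1)
  (f (s i) (t j) *: lag t j)%:P * map_poly polyC (lag s i)); split.
- apply: leq_trans (size_sum _ _ _) _; apply/bigmax_leqP => i _.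
  apply: leq_trans (size_sum _ _ _) _; apply/bigmax_leqP => j _.
  rewrite mul_polyC; apply: leq_trans (size_scale_leq _ _) _.
  by apply: leq_trans (size_poly _ _) (size_lag _ _).
- rewrite sizeYE rmorph_sum; apply: leq_trans (size_sum _ _ _) _.
  apply/bigmax_leqP => i _; rewrite rmorph_sum.
  apply: leq_trans (size_sum _ _ _) _; apply/bigmax_leqP => j _.
  rewrite rmorphM /= swapXY_polyC swapXY_map_polyC mulrC mul_polyC.
  apply: leq_trans (size_scale_leq _ _) _.
  apply: leq_trans (size_poly _ _) _.
  by apply: leq_trans (size_scale_leq _ _) (size_lag _ _).
move=> m1 m2 h1 h2.
have [k1 ->] : exists k : 'I_l.+1, m1 = k by exists (Ordinal (h1 : (m1 < l.+1)%N)).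
have [k2 ->] : exists k : 'I_l.+1, m2 = k by exists (Ordinal (h2 : (m2 < l.+1)%N)).
have E (i j : 'I_l.+1) : ((f (s i) (t j) *: lag t j)%:P *
    map_poly polyC (lag s i)).[s k1, t k2] =
    f (s i) (t j) * (j == k2)%:R * (i == k1)%:R.
  by rewrite hornerM hornerC horner_map hornerM hornerC hornerZ !lag_eval.
rewrite horner_sum horner_sum (bigD1 k1) //= [X in _ + X]big1 ?addr0; last first.
  move=> i /negPf ik; rewrite horner_sum horner_sum big1 // => j _.
  by rewrite E ik mulr0.
rewrite horner_sum horner_sum (bigD1 k2) //= big1 ?addr0; last first.
  by move=> j /negPf jk; rewrite E jk mulr0 mul0r.
by rewrite E !eqxx !mulr1.
Qed.
End Interpolation.

(* p^l_k. By [interpolantP] and [interpolates_unique], it is the unique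
   polynomial with the interpolation property as long as the stencils lie in
   the grids; 0 is a junk value, for index ranges outside the grids only. *)
Definition interpolant (R : realType) (x1 x2 : nat -> R) (f : R -> R -> R)
    (i1 i2 r l : nat) (k : nat * nat) : {poly {poly R}} :=
  xget 0 [set p | interpolates f l (stencil x1 i1 r k.1) (stencil x2 i2 r k.2) p]%classic.

Lemma grid_stencil_inj (R : realType) (a b : R) J x i r k l :
  is_grid a b J x -> (i - r + k + l <= J)%N -> inj_upto l (stencil x i r k).
Proof.
case=> _ _ incr le_J.
have lt_x m n : (m < n)%N -> (n <= J)%N -> x m < x n.
  elim: n => // n IHn; rewrite ltnS leq_eqVlt => /predU1P[-> nJ|mn nJ].
    exact: incr.
  by apply: lt_trans (incr _ nJ); apply: IHn => //; apply: ltnW.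
have bnd n : (n <= l)%N -> (i - r + k + n <= J)%N.
  by move=> nl; apply: leq_trans le_J; rewrite leq_add2l.
move=> m n ml nl; rewrite /stencil => e.
case: (ltngtP m n) => // mn.
  by have := @lt_x (i - r + k + m)%N (i - r + k + n)%N;
    rewrite ltn_add2l e ltxx => /(_ mn (bnd _ nl)).
by have := @lt_x (i - r + k + n)%N (i - r + k + m)%N;
  rewrite ltn_add2l e ltxx => /(_ mn (bnd _ ml)).
Qed.

Lemma interpolantP (R : realType) (a1 b1 a2 b2 : R) J1 J2 x1 x2 f i1 i2 r l k :
  is_grid a1 b1 J1 x1 -> is_grid a2 b2 J2 x2 ->
  (i1 - r + k.1 + l <= J1)%N -> (i2 - r + k.2 + l <= J2)%N ->
  interpolates f l (stencil x1 i1 r k.1) (stencil x2 i2 r k.2)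
    (interpolant x1 x2 f i1 i2 r l k).
Proof.
move=> g1 g2 h1 h2.
apply: (@xgetPex _ _ [set p | interpolates f l _ _ p]%classic).
by apply: interpolates_exists; [exact: grid_stencil_inj g1 h1
                               |exact: grid_stencil_inj g2 h2].
Qed.

(* The univariate weight C^l_{k,k'}, only meaningful for k' = k or k' = k + 1. *)
Definition weight (R : realType) (x : nat -> R) (i r l k k' : nat) (t : R) : R :=
  if k' == k then
    (t - x (i - r + k + l + 1)%N) / (x (i - r + k)%N - x (i - r + k + l + 1)%N)
  else if k' == k.+1 then
    (x (i - r + k)%N - t) / (x (i - r + k)%N - x (i - r + k + l + 1)%N)
  else 0.

Definition weight2 (R : realType) (x1 x2 : nat -> R) (i1 i2 r l : nat)
    (j j' : nat * nat) (t1 t2 : R) : R :=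
  weight x1 i1 r l j.1 j'.1 t1 * weight x2 i2 r l j.2 j'.2 t2.

(* Main.v *)
Require Import Defs.
From mathcomp Require Import all_boot all_order all_algebra.
From mathcomp Require Import reals.
From mathcomp Require Import zify.

(** The argument is the two-variable form of the Aitken-Neville recursion.  In
    one variable, the nodes s 0, ..., s l.+1 carry two affine weights: they sum
    to 1, the first vanishes at the last node and the second at the first node.
    The weight number d (d = 0, 1) thus vanishes at the only node missing from
    the shifted stencil s d, ..., s (d + l).

    In two variables the weights are products of univariate ones.  At a node of
    the large stencil, each of the four interpolants of degree l either equals f
    there or is multiplied by a weight that vanishes, so the combination has the
    value of f times the sum of the weights, which is 1.  It gains one degree in
    each variable ([neville_interpolates]), hence uniqueness of interpolation
    identifies it with the interpolant of degree l.+1. *)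

Set Implicit Arguments.
Unset Strict Implicit.
Unset Printing Implicit Defensive.

Import Order.TTheory GRing.Theory Num.Theory.
Local Open Scope ring_scope.

Lemma size_affineM (S : nzRingType) n (a p : {poly S}) :
  (size a <= 2)%N -> (size p <= n.+1)%N -> (size (a * p)%R <= n.+2)%N.
Proof.
move=> ha hp; apply: leq_trans (size_polyMleq _ _) _.
by rewrite -subn1 leq_subLR; apply: leq_add ha hp.
Qed.

Section Neville.
Variables (R : realType) (l : nat).

(** The weights as polynomials rather than functions, so that combinations of
    interpolants are again polynomials, to which uniqueness applies. *)
Definition neville (s : nat -> R) (d : 'I_2) : {poly R} :=
  (s 0%N - s l.+1)^-1 *:
    (if d == 0 then 'X - (s l.+1)%:P else (s 0%N)%:P - 'X).

Lemma size_neville s d : (size (neville s d) <= 2)%N.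
Proof.
apply: leq_trans (size_scale_leq _ _) _.
by case: ifP => _; [|rewrite -opprB size_polyN]; rewrite size_XsubC.
Qed.

Lemma sum_neville s t : s 0%N != s l.+1 -> \sum_d (neville s d).[t] = 1.
Proof.
move=> s_neq; rewrite !big_ord_recl big_ord0 addr0 /neville /= !hornerE /=.
by rewrite -mulrDr [X in _ * X]addrC subrKA mulVf // subr_eq0.
Qed.

(** What makes the recursion work: only values of the [d]-th interpolant at its
    own nodes are ever seen. *)
Lemma neville_node s d m : (m <= l.+1)%N ->
  (neville s d).[s m] = 0 \/ exists2 n, (n <= l)%N & m = (d + n)%N.
Proof.
case: d => [[|[|//]] lt_d2] le_m; rewrite /neville /= hornerZ.
  move: le_m; rewrite leq_eqVlt => /predU1P[->|lt_m]; last by right; exists m.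
  by left; rewrite hornerXsubC subrr mulr0.
case: m le_m => [_|m lt_m]; last by right; exists m.
by left; rewrite !hornerE subrr mulr0.
Qed.

Definition neville2 (s t : nat -> R) (p : 'I_2 * 'I_2 -> {poly {poly R}}) :
    {poly {poly R}} :=
  \sum_d map_poly polyC (neville s d.1) * ((neville t d.2)%:P * p d).

Lemma horner_neville2 s t p u v :
  (neville2 s t p).[u, v] =
  \sum_d (neville s d.1).[u] * (neville t d.2).[v] * (p d).[u, v].
Proof.
rewrite /neville2 !horner_sum; apply: eq_bigr => d _.
by rewrite !hornerM horner_map /= !hornerC mulrA.
Qed.

Lemma neville_interpolates (f : R -> R -> R) s t
    (p : 'I_2 * 'I_2 -> {poly {poly R}}) :
  s 0%N != s l.+1 -> t 0%N != t l.+1 ->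
  (forall d : 'I_2 * 'I_2,
     interpolates f l (fun m => s (d.1 + m)%N) (fun m => t (d.2 + m)%N) (p d)) ->
  interpolates f l.+1 s t (neville2 s t p).
Proof.
move=> s_neq t_neq p_int; split.
- apply: leq_trans (size_sum _ _ _) _; apply/bigmax_leqP => d _.
  have [sz_p _ _] := p_int d; apply: size_affineM.
    exact: leq_trans (size_poly _ _) (size_neville _ _).
  by rewrite mul_polyC; apply: leq_trans (size_scale_leq _ _) _.
- rewrite sizeYE rmorph_sum; apply: leq_trans (size_sum _ _ _) _.
  apply/bigmax_leqP => d _; have [_ + _] := p_int d; rewrite sizeYE => sz_p.
  rewrite !rmorphM /= swapXY_map_polyC swapXY_polyC mul_polyC.
  apply: leq_trans (size_scale_leq _ _) _; apply: size_affineM sz_p.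
  exact: leq_trans (size_poly _ _) (size_neville _ _).
move=> m1 m2 le_m1 le_m2; rewrite horner_neville2.
transitivity (\sum_(d : 'I_2 * 'I_2) (neville s d.1).[s m1] *
                (neville t d.2).[t m2] * f (s m1) (t m2)).
  apply: eq_bigr => d _; have [_ _ p_val] := p_int d.
  have [->|[n1 le_n1 ->]] := neville_node s d.1 le_m1; first by rewrite !mul0r.
  have [->|[n2 le_n2 ->]] := neville_node t d.2 le_m2.
    by rewrite !(mulr0, mul0r).
  by rewrite p_val.
rewrite -mulr_suml -(pair_bigA _ (fun d1 d2 =>
  (neville s d1).[s m1] * (neville t d2).[t m2])) /= -big_distrlr /=.
by rewrite !sum_neville // !mul1r.
Qed.

End Neville.

Lemma weightE (R : realType) (x : nat -> R) i r l k (d : 'I_2) t :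
  weight x i r l k (k + d)%N t = (neville l (stencil x i r k) d).[t].
Proof.
rewrite /weight /neville /stencil addn0 addn1 -addnS hornerZ.
case: d => [[|[|//]] lt_d2] /=; first by rewrite addn0 eqxx hornerXsubC mulrC.
by rewrite addn1 eqn_leq ltnn eqxx !hornerE mulrC.
Qed.

Theorem lemma4p1 (R : realType) (a1 b1 a2 b2 : R) (J1 J2 : nat)
    (x1 x2 : nat -> R) (f : R -> R -> R) (r i1 i2 l j1 j2 : nat) (t1 t2 : R)
    (Hx1 : is_grid a1 b1 J1 x1) (Hx2 : is_grid a2 b2 J2 x2)
    (Hr : (0 < r)%N)
    (Hi1 : (r <= i1)%N) (HJ1 : (i1 + r - 1 <= J1)%N)
    (Hi2 : (r <= i2)%N) (HJ2 : (i2 + r - 1 <= J2)%N)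
    (Hl : (r <= l <= 2 * r - 2)%N)
    (Ht1 : x1 (i1 - 1)%N <= t1 <= x1 i1)
    (Ht2 : x2 (i2 - 1)%N <= t2 <= x2 i2)
    (Hj1 : (j1 <= 2 * r - 2 - l)%N) (Hj2 : (j2 <= 2 * r - 2 - l)%N) :
  let p := interpolant x1 x2 f i1 i2 r in
  let C1 := weight x1 i1 r l in
  let C2 := weight x2 i2 r l in
  let C := weight2 x1 x2 i1 i2 r l in
  let y1 k := x1 (i1 - r + k)%N in
  let y2 k := x2 (i2 - r + k)%N in
  [/\ (p l.+1 (j1, j2)).[t1, t2] =
        \sum_(d : 'I_2 * 'I_2)
          C (j1, j2) ((j1 + d.1)%N, (j2 + d.2)%N) t1 t2 *
          (p l ((j1 + d.1)%N, (j2 + d.2)%N)).[t1, t2],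
      C (j1, j2) (j1, j2) t1 t2 =
        ((t1 - y1 (j1 + l + 1)%N) / (y1 j1 - y1 (j1 + l + 1)%N)) *
        ((t2 - y2 (j2 + l + 1)%N) / (y2 j2 - y2 (j2 + l + 1)%N)) /\
      ((t1 - y1 (j1 + l + 1)%N) / (y1 j1 - y1 (j1 + l + 1)%N)) *
        ((t2 - y2 (j2 + l + 1)%N) / (y2 j2 - y2 (j2 + l + 1)%N)) =
        C1 j1 j1 t1 * C2 j2 j2 t2,
      C (j1, j2) (j1.+1, j2) t1 t2 =
        ((y1 j1 - t1) / (y1 j1 - y1 (j1 + l + 1)%N)) *
        ((t2 - y2 (j2 + l + 1)%N) / (y2 j2 - y2 (j2 + l + 1)%N)) /\
      ((y1 j1 - t1) / (y1 j1 - y1 (j1 + l + 1)%N)) *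
        ((t2 - y2 (j2 + l + 1)%N) / (y2 j2 - y2 (j2 + l + 1)%N)) =
        C1 j1 j1.+1 t1 * C2 j2 j2 t2,
      C (j1, j2) (j1, j2.+1) t1 t2 =
        ((t1 - y1 (j1 + l + 1)%N) / (y1 j1 - y1 (j1 + l + 1)%N)) *
        ((y2 j2 - t2) / (y2 j2 - y2 (j2 + l + 1)%N)) /\
      ((t1 - y1 (j1 + l + 1)%N) / (y1 j1 - y1 (j1 + l + 1)%N)) *
        ((y2 j2 - t2) / (y2 j2 - y2 (j2 + l + 1)%N)) =
        C1 j1 j1 t1 * C2 j2 j2.+1 t2 &
      C (j1, j2) (j1.+1, j2.+1) t1 t2 =
        ((y1 j1 - t1) / (y1 j1 - y1 (j1 + l + 1)%N)) *
        ((y2 j2 - t2) / (y2 j2 - y2 (j2 + l + 1)%N)) /\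
      ((y1 j1 - t1) / (y1 j1 - y1 (j1 + l + 1)%N)) *
        ((y2 j2 - t2) / (y2 j2 - y2 (j2 + l + 1)%N)) =
        C1 j1 j1.+1 t1 * C2 j2 j2.+1 t2].
Proof.
move=> p C1 C2 C y1 y2.
have size_stencil (i J j : nat) : (r <= i)%N -> (i + r - 1 <= J)%N ->
    (j <= 2 * r - 2 - l)%N -> (i - r + j + l.+1 <= J)%N by lia.
have := size_stencil _ _ _ Hi1 HJ1 Hj1; have := size_stencil _ _ _ Hi2 HJ2 Hj2.
move=> le_J2 le_J1 {size_stencil}.
have C_formulas := (eqxx, eqn_leq, ltnn, addnA).
split; try by rewrite /C /weight2 /C1 /C2 /weight /y1 /y2 /= !C_formulas.
set s := stencil x1 i1 r j1; set t := stencil x2 i2 r j2.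
have s_inj : inj_upto l.+1 s := grid_stencil_inj Hx1 le_J1.
have t_inj : inj_upto l.+1 t := grid_stencil_inj Hx2 le_J2.
have ends_neq u : inj_upto l.+1 u -> u 0%N != u l.+1 :> R.
  by move=> u_inj; apply/eqP => /u_inj-/(_ isT (leqnn _)).
pose q (d : 'I_2 * 'I_2) := p l ((j1 + d.1)%N, (j2 + d.2)%N).
have q_int (d : 'I_2 * 'I_2) : interpolates f l (fun m => s (d.1 + m)%N)
    (fun m => t (d.2 + m)%N) (q d).
  have [||q1 q2 q_val] := @interpolantP _ _ _ _ _ _ _ _ _ f i1 i2 r l
    ((j1 + d.1)%N, (j2 + d.2)%N) Hx1 Hx2.
  - by have := ltn_ord d.1; move: le_J1 => /=; lia.
  - by have := ltn_ord d.2; move: le_J2 => /=; lia.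
  split=> // m1 m2 le_m1 le_m2; move: (q_val _ _ le_m1 le_m2).
  by rewrite /s /t /stencil /= !addnA.
have -> : p l.+1 (j1, j2) = neville2 l s t q.
  apply: (interpolates_unique s_inj t_inj).
    exact: (interpolantP (k := (j1, j2)) f Hx1 Hx2 le_J1 le_J2).
  by apply: neville_interpolates q_int; apply: ends_neq.
rewrite horner_neville2; apply: eq_bigr => d _.
by rewrite /C /weight2 /= !weightE.
Qed.
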